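(* For each of the following choices of $\mu$ and $\sigma^2$, the stationary probability density function of the Itô process $dZ_t=\mu(Z_t)\,dt+\sigma(Z_t)\,dW_t$ is the density of the indicated distribution: (i) Gaussian $N(a,b)$: $\mu(z)=-(z-a)$, $\sigma^2(z)=2b$; (ii) Beta $B(a,b)$: $\mu(z)=-\big(z-\frac{a}{a+b}\big)$, $\sigma^2(z)=\frac{2}{a+b}\,z(1-z)$; (iii) Gamma $\Gamma(a,b)$: $\mu(z)=-\big(z-\frac ab\big)$, $\sigma^2(z)=\frac{2z}{b}$; (iv) Laplace $L(a,b)$: $\mu(z)=-(z-a)$, $\sigma^2(z)=2b|z-a|+2b^2$.
   Context: $W_t$ is a standard one-dimensional Wiener process. A stationary PDF of $Z_t$ is a probability density that solves the steady-state Fokker–Planck equation $\frac12\frac{d^2(\sigma^2p)}{dz^2}=\frac{d(\mu p)}{dz}$ on the support of the distribution. Parametrizations: $N(a,b)$ has mean $a$ and variance $b>0$; $B(a,b)$ has density proportional to $z^{a-1}(1-z)^{b-1}$ on $(0,1)$, $a,b>0$; $\Gamma(a,b)$ has density proportional to $z^{a-1}e^{-bz}$ on $(0,\infty)$ (shape $a>0$, rate $b>0$); $L(a,b)$ has density $\frac{1}{2b}e^{-|z-a|/b}$ on $\mathbb{R}$, $b>0$. *)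

(* Defs.v *)
From mathcomp Require Import all_boot all_order all_algebra.
From mathcomp Require Import all_classical all_reals all_analysis.
Import Order.TTheory GRing.Theory Num.Theory.
Import numFieldNormedType.Exports.

Set Implicit Arguments.
Unset Strict Implicit.
Unset Printing Implicit Defensive.

Local Open Scope classical_set_scope.
Local Open Scope ring_scope.

Definition is_pdf (R : realType) (p : R -> R) : Prop :=
  [/\ measurable_fun [set: R] p,
      forall z, 0 <= p z
    & (\int[@lebesgue_measure R]_z (p z)%:E = 1)%E].

Definition pdf_support (R : realType) (p : R -> R) : set R :=
  closure [set z | p z != 0].

(* The steady-state Fokker-Planck equation at z, in the classical sense. The
   derivability conditions are explicit because [derive1] is a total operator. *)
Definition steady_fokker_planck_at (R : realType) (mu sigma p : R -> R) (z : R)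
    : Prop :=
  let D := fun x => sigma x ^+ 2 * p x in
  let F := fun x => mu x * p x in
  [/\ derivable D z 1, derivable (derive1 D) z 1, derivable F z 1
    & 2^-1 * derive1 (derive1 D) z = derive1 F z].

(* Stationary density of dZ = mu(Z) dt + sigma(Z) dW. The equation is imposed
   on the interior of the support: at a finite endpoint, where a beta or gamma
   density may blow up, the two-sided derivatives need not exist. *)
Definition is_stationary_pdf (R : realType) (mu sigma p : R -> R) : Prop :=
  is_pdf p /\
  forall z, (pdf_support p)° z -> steady_fokker_planck_at mu sigma p z.

(* The density on S proportional to g, extended by 0 outside S. The normalizing
   integral is 0 by convention if it diverges to +oo, in which case the
   result is the zero function, hence not a density. *)
Definition normalized (R : realType) (S : set R) (g : R -> R) : R -> R :=
  fun z => \1_S z * g z / (\int[@lebesgue_measure R]_(x in S) g x)%R.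

(* [normal_pdf] takes the standard deviation; here b is the variance. *)
Definition gaussian_density (R : realType) (a b : R) : R -> R :=
  normal_pdf a (Num.sqrt b).

(* The library's [beta_pdf] only covers natural parameters. *)
Definition beta_density (R : realType) (a b : R) : R -> R :=
  normalized `]0, 1[ (fun z => z `^ (a - 1) * (1 - z) `^ (b - 1)).

Definition gamma_density (R : realType) (a b : R) : R -> R :=
  normalized `]0, +oo[ (fun z => z `^ (a - 1) * expR (- (b * z))).

Definition laplace_density (R : realType) (a b : R) : R -> R :=
  fun z => (2 * b)^-1 * expR (- (`|z - a| / b)).

(* Main.v *)
Require Import Defs.
From mathcomp Require Import all_boot all_order all_algebra.
From mathcomp Require Import all_classical all_reals all_analysis.
From mathcomp Require Import measurable_realfun.
From mathcomp Require Import ring lra.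
Import Order.TTheory GRing.Theory Num.Theory.
Import numFieldNormedType.Exports.
Local Open Scope classical_set_scope.
Local Open Scope ring_scope.

(* In each of the four cases the probability flux [mu p - (sigma^2 p)' / 2]
   vanishes identically on the support, i.e. [(sigma^2 p)' = 2 mu p], and
   differentiating once more gives the steady-state Fokker-Planck equation.
   Up to constants, [sigma^2 p] is [p] itself for the Gaussian law,
   [z^a (1-z)^b] for the beta law, [z^a exp(-bz)] for the gamma law and
   [(|z-a| + b) exp(-|z-a|/b)] for the Laplace law, the latter being
   twice differentiable even at [z = a]. *)

(** * Stationarity from a vanishing flux *)

(** [D] and [F] are closed forms of [sigma^2 p] and [mu p] on [S]. As [S] is open, the equalities
    hold near each of its points and so pass to derivatives. *)
Lemma steady_fokker_planck_zero_flux (R : realType) (S : set R)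
    (mu sigma p D F : R -> R) (z : R) :
  open S -> S z ->
  (forall x, S x -> sigma x ^+ 2 * p x = D x) ->
  (forall x, S x -> mu x * p x = F x) ->
  (forall x, S x -> is_derive x 1 D (2 * F x)) ->
  derivable F z 1 ->
  steady_fokker_planck_at mu sigma p z.
Proof.
move=> oS Sz DE FE dD dF.
have nS x : S x -> \forall y \near x, S y by move=> Sx; exact: open_nbhs_nbhs.
have dD' x : S x -> is_derive x 1 (fun y => sigma y ^+ 2 * p y) (2 * F x).
  move=> Sx; apply: near_eq_is_derive (dD x Sx).
  by near=> y; rewrite DE//; near: y; exact: nS.
(* This is needed on a whole neighbourhood of [z], since both sides are differentiated once more. *)
have D'E : \forall x \near z,
    2 * F x = derive1 (fun y => sigma y ^+ 2 * p y) x.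
  near=> x; have Sx : S x by near: x; exact: nS.
  by rewrite derive1E; have [_ ->] := dD' x Sx.
have FE' : \forall x \near z, F x = mu x * p x.
  by near=> x; rewrite FE//; near: x; exact: nS.
have d2F : is_derive z 1 (fun x => 2 * F x) (2 * 'D_1 F z).
  by apply: is_deriveZ; exact/derivableP.
split.
- by have [] := dD' z Sz.
- by apply: near_eq_derivable D'E _; have [] := d2F.
- exact: near_eq_derivable FE' dF.
- rewrite !derive1E -(near_eq_derive _ D'E) -(near_eq_derive _ FE').
  by have [_ ->] := d2F; rewrite mulKf.
Unshelve. all: by end_near. Qed.

(** A positive function on a set of positive measure cannot have integral 0, since it would vanish
    almost everywhere there. Finiteness of the integral keeps [fine] from returning its default
    value 0. *)
Lemma is_pdf_normalized (R : realType) (S : set R) (g : R -> R) :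
  measurable S -> (0 < @lebesgue_measure R S)%E ->
  measurable_fun [set: R] g -> (forall x, S x -> 0 < g x) ->
  (\int[@lebesgue_measure R]_(x in S) (g x)%:E < +oo)%E ->
  0 < (\int[@lebesgue_measure R]_(x in S) g x)%R /\ is_pdf (normalized S g).
Proof.
move=> mS S0 mg g0 gy.
have mgS : measurable_fun S (fun x => (g x)%:E).
  by apply/measurable_EFinP; exact: measurable_funTS.
have I0 : (0 <= \int[@lebesgue_measure R]_(x in S) (g x)%:E)%E.
  by apply: integral_ge0 => x Sx; rewrite lee_fin ltW// g0.
have Z0 : 0 < (\int[@lebesgue_measure R]_(x in S) g x)%R.
  rewrite fine_gt0// gy andbT lt_neqAle I0 andbT; apply/eqP => I00.
  have [] := ae_eq_integral_abs (@lebesgue_measure R) mS mgS => + _.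
  have gE : (\int[@lebesgue_measure R]_(x in S) `|(g x)%:E| = 0)%E.
    rewrite I00; apply: eq_integral => x; rewrite inE => Sx /=.
    by rewrite gtr0_norm// g0.
  move=> /(_ gE) aeg.
  suff : (@lebesgue_measure R S = 0)%E by move=> SE; rewrite SE ltxx in S0.
  (* Since [g] is positive on [S], the exceptional set contains all of [S]. *)
  apply/negligibleP => //; apply: negligibleS aeg => x Sx/= /(_ Sx) [gx0].
  by have := g0 x Sx; rewrite gx0 ltxx.
split=> //; split.
- by apply: measurable_funM => //; exact: measurable_funM.
- move=> z; rewrite /normalized indicE; case: (boolP (z \in S)).
    by rewrite inE => Sz; rewrite mul1r divr_ge0 ?ltW// g0.
  by rewrite !mul0r.
- transitivity (\int[@lebesgue_measure R]_(x in S)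
      (((Rintegral (@lebesgue_measure R) S g)^-1)%:E * (g x)%:E))%E.
    rewrite [RHS]integral_mkcond; apply: eq_integral => x _.
    rewrite patchE /normalized indicE; case: ifPn => _; last by rewrite !mul0r.
    by rewrite mul1r mulrC EFinM.
  rewrite ge0_integralZl//= ?lee_fin ?invr_ge0 ?ltW//; last first.
    by move=> x Sx; rewrite lee_fin ltW// g0.
  rewrite -[X in (_ * X)%E]fineK; last by rewrite ge0_fin_numE.
  by rewrite -EFinM mulVf// gt_eqF.
Qed.

(** The equation is linear in the density, so the normalizing constant [c] cancels and it suffices
    to study the kernel [g]. The condition on the interior of the closure of [S] places the interior
    of the support inside [S], where the density is [c * g]. *)
Lemma is_stationary_pdf_normalized (R : realType) (S : set R)
    (mu sigma g D : R -> R) :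
  open S -> (closure S)° `<=` S -> (0 < @lebesgue_measure R S)%E ->
  measurable_fun [set: R] g -> (forall x, S x -> 0 < g x) ->
  (\int[@lebesgue_measure R]_(x in S) (g x)%:E < +oo)%E ->
  (forall x, S x -> sigma x ^+ 2 * g x = D x) ->
  (forall x, S x -> is_derive x 1 D (2 * (mu x * g x))) ->
  (forall x, S x -> derivable (fun y => mu y * g y) x 1) ->
  is_stationary_pdf mu sigma (normalized S g).
Proof.
move=> oS cS S0 mg g0 gy DE dD dF.
have [Z0 pdf] := is_pdf_normalized _ _ _ (open_measurable oS) S0 mg g0 gy.
split=> // z zS.
have Sz : S z.
  apply: cS; apply: interiorS zS; apply: closureS => x /=.
  by apply: contra_neqP => Sx; rewrite /normalized indicE memNset// !mul0r.
set c := (Rintegral (@lebesgue_measure R) S g)^-1.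
have pE x : S x -> normalized S g x = c * g x.
  by move=> Sx; rewrite /normalized indicE mem_set// mul1r mulrC.
apply: (@steady_fokker_planck_zero_flux _ S _ _ _ (fun x => c * D x)
  (fun x => c * (mu x * g x))) => //.
- by move=> x Sx; rewrite pE// mulrCA DE.
- by move=> x Sx; rewrite pE// mulrCA.
- move=> x Sx; have ? := dD x Sx.
  by apply: is_derive_eq; rewrite /GRing.scale/=; ring.
- exact/derivableZ/dF.
Qed.

(** * Bounding improper integrals and gluing derivatives *)

(** The fundamental theorem of calculus on each [[u n, v n]], then monotone convergence along these
    growing intervals. Only a bound on the increments of [F] is asked for, so no limit of [F] at the
    open ends has to be computed. *)
Lemma ge0_integral_primitive_le (R : realType) (f F : R -> R) (u v : nat -> R)
    (M : R) :
  {homo u : m n / (m <= n)%N >-> n <= m} ->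
  {homo v : m n / (m <= n)%N >-> m <= n} ->
  (forall n, u n < v n) ->
  (forall n x, u n <= x <= v n -> [/\ 0 <= f x, derivable f x 1
    & is_derive x 1 F (f x)]) ->
  (forall n, F (v n) - F (u n) <= M) ->
  (\int[@lebesgue_measure R]_(x in \bigcup_n `[u n, v n]%classic) (f x)%:E
    <= M%:E)%E.
Proof.
move=> du iv uv fF FM.
have cf n : {within `[u n, v n]%classic, continuous f}.
  apply: derivable_within_continuous => x; rewrite in_itv/= => /fF.
  by case.
have cF n x : u n <= x <= v n -> {for x, continuous F}.
  move=> /fF[_ _ [dF _]].
  exact/differentiable_continuous/derivable1_diffP.
have If n : (\int[@lebesgue_measure R]_(x in `[u n, v n]) (f x)%:E
    = (F (v n) - F (u n))%:E)%E.
  rewrite (continuous_FTC2 (F := F)) ?EFinB//.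
  - split.
    + move=> x; rewrite in_itv/= => /andP[ux xv].
      by have [|_ _ []//] := fF n x; rewrite !ltW.
    + by apply/cvg_at_right_filter/(cF n); rewrite lexx ltW.
    + by apply/cvg_at_left_filter/(cF n); rewrite lexx ltW.
  - move=> x; rewrite in_itv/= => /andP[ux xv]; rewrite derive1E.
    by have [|_ _ []//] := fF n x; rewrite !ltW.
suff cvgI : (\int[@lebesgue_measure R]_(x in `[u n, v n]) (f x)%:E
    @[n --> \oo]
    --> \int[@lebesgue_measure R]_(x in \bigcup_n `[u n, v n]%classic)
          (f x)%:E)%E.
  by apply: cvge_to_le cvgI _; near=> n; rewrite If lee_fin.
apply: (@ge0_nondecreasing_set_cvg_integral _ (measurableTypeR R) R
  (fun n => `[u n, v n]%classic) (EFin \o f)).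
- move=> m n mn; rewrite subsetEset => x/=; rewrite !in_itv/= => /andP[ux xv].
  by rewrite (le_trans (du _ _ mn) ux) (le_trans xv (iv _ _ mn)).
- by move=> n; exact: measurable_itv.
- move=> n; apply/measurable_EFinP.
  exact: subspace_continuous_measurable_fun.
- by move=> n x /=; rewrite in_itv/= lee_fin => /fF[].
Unshelve. all: by end_near. Qed.

(** Meant for functions of [|x - a|]: each formula has to be differentiable only on its own closed
    side, and at [a] itself both must have the same derivative [l]. *)
Lemma is_derive_glue (R : realType) (f f1 f2 : R -> R) (a l z : R) :
  (forall x, a <= x -> f x = f1 x) -> (forall x, x <= a -> f x = f2 x) ->
  (a <= z -> is_derive z 1 f1 l) -> (z <= a -> is_derive z 1 f2 l) ->
  is_derive z 1 f l.
Proof.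
move=> f1E f2E d1 d2; have [az|za|za] := ltgtP a z.
- apply: near_eq_is_derive (d1 (ltW az)); near=> x; rewrite f1E// ltW//.
  by near: x; exact: lt_nbhsr.
- apply: near_eq_is_derive (d2 (ltW za)); near=> x; rewrite f2E// ltW//.
  by near: x; exact: lt_nbhsl.
- subst z; have {d1} [d1 d1E] := d1 (lexx _); have {d2} [d2 d2E] := d2 (lexx _).
  suff fl : (fun h => h^-1 *: (f (h *: 1 + a) - f a)) @ 0^' --> l.
    by split; [apply/cvg_ex; exists l|exact: cvg_lim].
  have {}d1 : (fun h => h^-1 *: (f1 (h *: 1 + a) - f1 a)) @ 0^' --> l.
    by rewrite -d1E.
  have {}d2 : (fun h => h^-1 *: (f2 (h *: 1 + a) - f2 a)) @ 0^' --> l.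
    by rewrite -d2E.
  apply/cvgrPdist_le => e e0.
  move/cvgrPdist_le : d1 => /(_ e e0) d1.
  move/cvgrPdist_le : d2 => /(_ e e0) d2.
  (* The sign of [h] decides which of the two difference quotients is that of [f]; both are within
     [e] of [l]. *)
  near=> h; have [h0|h0] := leP 0 h.
    have ah : a <= h *: 1 + a by rewrite [h *: 1]mulr1 lerDr.
    by rewrite !f1E//; near: h.
  have ah : h *: 1 + a <= a by rewrite [h *: 1]mulr1 gerDr ltW.
  by rewrite !f2E//; near: h.
Unshelve. all: by end_near. Qed.

(** * The Gaussian law *)

Lemma is_stationary_pdf_gaussian (R : realType) (a b : R) (sigma : R -> R) :
  0 < b -> (forall z, sigma z ^+ 2 = 2 * b) ->
  is_stationary_pdf (fun z => - (z - a)) sigma (gaussian_density a b).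
Proof.
move=> b0 sE.
have s0 : Num.sqrt b != 0 by rewrite gt_eqF// sqrtr_gt0.
have bN0 : b != 0 by rewrite gt_eqF.
split=> [|z _].
  split; [exact: measurable_normal_pdf|exact: normal_pdf_ge0|].
  exact: integral_normal_pdf.
have pE x : gaussian_density a b x =
    normal_peak (Num.sqrt b) * expR (- ((x - a) ^+ 2 / (2 * b))).
  rewrite /gaussian_density normal_pdfE// /normal_fun sqr_sqrtr ?ltW//.
  by rewrite mulNr -[b *+ 2]mulr_natl.
(* The identity [p' = -(x - a) / b * p] is the zero-flux condition, because [sigma^2] is the
   constant [2 * b]. *)
have dp (x : R) : is_derive x 1
    (fun y => normal_peak (Num.sqrt b) * expR (- ((y - a) ^+ 2 / (2 * b))))
    (- (x - a) / b * gaussian_density a b x).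
  by apply: is_derive_eq; rewrite pE /GRing.scale/=; field.
have dp' (x : R) : is_derive x 1 (gaussian_density a b)
    (- (x - a) / b * gaussian_density a b x).
  by rewrite (_ : gaussian_density a b = (fun y => normal_peak (Num.sqrt b) *
    expR (- ((y - a) ^+ 2 / (2 * b))))); [rewrite -pE|exact/funext].
apply: (@steady_fokker_planck_zero_flux _ setT _ _ _
  (fun x => 2 * b * gaussian_density a b x)
  (fun x => - (x - a) * gaussian_density a b x)) => //.
- exact: openT.
- by move=> x _; rewrite sE.
- by move=> x _; apply: is_derive_eq; rewrite /GRing.scale/=; field.
Qed.

(** * The Laplace law *)

(** The substitution [y = (z - a) / b] reduces to the standard Laplace density [g], whose evenness
    leaves twice an integral over the half-line with primitive [- exp(-x) / 2]. *)
Lemma integral_laplace_density (R : realType) (a b : R) : 0 < b ->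
  (\int[@lebesgue_measure R]_z (laplace_density a b z)%:E = 1)%E.
Proof.
move=> b0; have bN0 : b != 0 by rewrite gt_eqF.
pose g (x : R) : R := 2^-1 * expR (- `|x|).
have cg : continuous g.
  move=> x; apply: cvgM; first exact: cvg_cst.
  apply: continuous_comp; last exact: continuous_expR.
  by apply: cvgN; exact: norm_continuous.
have g0 x : 0 <= g x by rewrite mulr_ge0 ?expR_ge0// invr_ge0.
have dF (x : R) : is_derive x 1 (fun y => (y - a) / b) b^-1.
  by apply: is_derive_eq; rewrite /GRing.scale/=; field.
have dFE : derive1 (fun y => (y - a) / b) = cst b^-1.
  by apply/funext => x; rewrite derive1E; have [_ ->] := dF x.
have gE : laplace_density a b = (fun x =>
    ((g \o (fun y => (y - a) / b)) * derive1 (fun y => (y - a) / b)) x).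
  apply/funext => x; rewrite dFE /g /laplace_density fctE/=.
  by rewrite normrM normfV (gtr0_norm b0); field.
rewrite gE -increasing_ge0_integration_by_substitutionT//; first last.
- apply/cvgryPge => A; near=> x; rewrite ler_pdivlMr// lerBrDr.
  by near: x; apply: nbhs_pinfty_ge; exact: num_real.
- apply/cvgrNyPle => A; near=> x; rewrite ler_pdivrMr// lerBlDr.
  by near: x; apply: nbhs_ninfty_le; exact: num_real.
- by rewrite dFE; exact: is_cvg_cst.
- by rewrite dFE; exact: is_cvg_cst.
- by rewrite dFE; exact: cst_continuous.
- by move=> x y xy; rewrite ltr_pM2r ?invr_gt0// ltrD2r.
rewrite ge0_symfun_integralT//; last by move=> x; rewrite /g/= normrN.
rewrite -set_itvcy
  (@ge0_continuous_FTC2y _ _ (fun x => - (2^-1 * expR (- x))) 0 0)//.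
- by rewrite oppr0 expR0 mulr1 sub0e EFinN oppeK -EFinM mulfV.
- exact: continuous_subspaceT.
- rewrite -oppr0; apply: cvgN; rewrite -[X in _ --> X](mulr0 2^-1).
  by apply: cvgM; [exact: cvg_cst|exact: cvgr_expR].
- apply: cvg_at_right_filter; apply: cvgN; apply: cvgM; first exact: cvg_cst.
  apply: continuous_comp; last exact: continuous_expR.
  by apply: cvgN; exact: cvg_id.
- move=> x; rewrite in_itv/= andbT => x0; rewrite derive1E derive_val.
  by rewrite /g gtr0_norm// /GRing.scale/=; ring.
Unshelve. all: by end_near. Qed.

(** The density has a kink at [a], but [sigma^2 p] and [mu p] have none: the two branches of the
    former both have derivative 0 at [a], those of the latter both have derivative [- p a]. *)
Lemma is_stationary_pdf_laplace (R : realType) (a b : R) (sigma : R -> R) :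
  0 < b -> (forall z, sigma z ^+ 2 = 2 * b * `|z - a| + 2 * b ^+ 2) ->
  is_stationary_pdf (fun z => - (z - a)) sigma (laplace_density a b).
Proof.
move=> b0 sE; have bN0 : b != 0 by rewrite gt_eqF.
have cp : continuous (laplace_density a b).
  move=> x; apply: cvgM; first exact: cvg_cst.
  apply: continuous_comp; last exact: continuous_expR.
  apply: cvgN; apply: cvgM; last exact: cvg_cst.
  apply: cvg_norm; apply: cvgB; [exact: cvg_id|exact: cvg_cst].
split=> [|z _].
  split; [exact: continuous_measurable_fun| |exact: integral_laplace_density].
  by move=> z; rewrite mulr_ge0 ?expR_ge0// invr_ge0 mulr_ge0// ltW.
have absr x : a <= x -> `|x - a| = x - a.
  by move=> ?; rewrite ger0_norm ?subr_ge0.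
have absl x : x <= a -> `|x - a| = a - x.
  by move=> ?; rewrite distrC ger0_norm ?subr_ge0.
apply: (@steady_fokker_planck_zero_flux _ setT _ _ _
  (fun x => (`|x - a| + b) * expR (- (`|x - a| / b)))
  (fun x => - (x - a) * laplace_density a b x)).
- exact: openT.
- by [].
- by move=> x _; rewrite sE /laplace_density; field.
- by [].
- move=> x _; apply: (@is_derive_glue _ _
    (fun y => ((y - a) + b) * expR (- ((y - a) / b)))
    (fun y => ((a - y) + b) * expR (- ((a - y) / b))) a) => [y /absr->//|
    y /absl->//|ax|xa].
  + apply: is_derive_eq; rewrite /laplace_density absr// /GRing.scale/=.
    by field.
  + apply: is_derive_eq; rewrite /laplace_density absl// /GRing.scale/=.
    by field.
- suff [l [] //] : exists l, is_derive (z : R) 1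
      (fun x => - (x - a) * laplace_density a b x) l.
  (* One formula serves both sides, as [p' = - p / b] to the right of [a] and [p' = p / b] to the
     left. *)
  exists ((`|z - a| / b - 1) * laplace_density a b z).
  apply: (@is_derive_glue _ _
    (fun y => - (y - a) * ((2 * b)^-1 * expR (- ((y - a) / b))))
    (fun y => - (y - a) * ((2 * b)^-1 * expR (- ((a - y) / b)))) a) => [y ay|
    y ya|ax|xa].
  + by rewrite /laplace_density absr.
  + by rewrite /laplace_density absl.
  + apply: is_derive_eq; rewrite /laplace_density absr// /GRing.scale/=.
    by field.
  + apply: is_derive_eq; rewrite /laplace_density absl// /GRing.scale/=.
    by field.
Qed.

(** * The beta law *)

Lemma powR_le1 (R : realType) (x r : R) : 0 <= r -> 0 <= x <= 1 -> x `^ r <= 1.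
Proof.
move=> r0 /andP[x0 x1].
by have := ge0_ler_powR r0 x0 ler01 x1; rewrite powR1.
Qed.

(** The power is at most 1 for nonnegative [r] and at most its value at [1/2] for negative [r]; the
    sum covers both signs. *)
Lemma powR_le_of_half_le (R : realType) (x r : R) :
  2^-1 <= x <= 1 -> x `^ r <= 1 + 2^-1 `^ r.
Proof.
move=> /andP[x2 x1]; have x0 : 0 < x by apply: lt_le_trans x2; rewrite invr_gt0.
have [r0|r0] := leP 0 r.
  rewrite -[leLHS]addr0 lerD ?powR_ge0//.
  by rewrite powR_le1// ltW.
rewrite -[leLHS]add0r lerD// -[r]opprK (powRN x) (powRN 2^-1).
rewrite lef_pV2 ?posrE ?powR_gt0 ?invr_gt0//.
by rewrite ge0_ler_powR// ?nnegrE ?oppr_ge0 ?invr_ge0// ltW.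
Qed.

Lemma is_derive_powR_onem (R : realType) (r x : R) : x < 1 ->
  is_derive x 1 (fun y => (1 - y) `^ r) (- (r * (1 - x) `^ (r - 1))).
Proof.
move=> x1; have x0 : 0 < 1 - x by rewrite subr_gt0.
have d1 : is_derive x 1 (fun y : R => 1 - y) (-1).
  by apply: is_derive_eq; ring.
have d2 := is_derive1_powR r x0.
have := @is_derive1_comp _ (fun y => y `^ r) (fun y : R => 1 - y) x _ _ d2 d1.
by move=> d; apply: (is_derive_eq d); rewrite mulrN1.
Qed.

Lemma measurable_beta_kernel (R : realType) (a b : R) :
  measurable_fun [set: R] (fun z => z `^ (a - 1) * (1 - z) `^ (b - 1)).
Proof.
apply: measurable_funM; first exact: measurable_powR.
apply: (measurableT_comp (measurable_powR (b - 1))).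
exact: measurable_funB.
Qed.

(* Away from each endpoint the factor singular at that endpoint is bounded, so
   a combination of [z^(a-1)] and [(1-z)^(b-1)] dominates the integrand. *)
Lemma integral_beta_kernel_lty (R : realType) (a b : R) : 0 < a -> 0 < b ->
  (\int[@lebesgue_measure R]_(z in `]0%R, 1%R[)
    (z `^ (a - 1) * (1 - z) `^ (b - 1))%:E < +oo)%E.
Proof.
move=> a0 b0.
have aN0 : a != 0 by rewrite gt_eqF.
have bN0 : b != 0 by rewrite gt_eqF.
(* [Ka] bounds [z^(a-1)] for [z] in [[1/2, 1]], [Kb] bounds [(1-z)^(b-1)] for [z] in [[0, 1/2]]. *)
pose Ka : R := 1 + 2^-1 `^ (a - 1); pose Kb : R := 1 + 2^-1 `^ (b - 1).
have Ka0 : 0 <= Ka by rewrite addr_ge0// powR_ge0.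
have Kb0 : 0 <= Kb by rewrite addr_ge0// powR_ge0.
pose f (z : R) : R := Kb * z `^ (a - 1) + Ka * (1 - z) `^ (b - 1).
pose F (z : R) : R := Kb / a * z `^ a - Ka / b * (1 - z) `^ b.
have f0 z : 0 <= f z by rewrite addr_ge0// mulr_ge0// powR_ge0.
have mf : measurable_fun [set: R] f.
  apply: measurable_funD; apply: measurable_funM => //.
  apply: (measurableT_comp (measurable_powR (b - 1))).
  exact: measurable_funB.
(* Starting at [1/3] gives [u n < 1/2], hence [u n < 1 - u n], already for [n = 0]. *)
pose u (n : nat) : R := n.+3%:R^-1.
have u0 n : 0 < u n by rewrite invr_gt0.
have u2 n : u n < 2^-1 by rewrite ltf_pV2 ?posrE// ltr_nat.
have du : {homo u : m n / (m <= n)%N >-> n <= m}.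
  by move=> m n mn; rewrite lef_pV2 ?posrE// ler_nat !ltnS.
have SE : `]0%R, 1%R[%classic = \bigcup_n `[u n, 1 - u n]%classic.
  apply/seteqP; split=> x /=.
    rewrite in_itv/= => /andP[x0 x1].
    have m0 : 0 < Num.min x (1 - x) by rewrite lt_min x0 subr_gt0.
    have [n /= nm] := filter_ex (near_infty_natSinv_lt (PosNum m0)).
    have : u n < Num.min x (1 - x).
      by apply: le_lt_trans nm; rewrite lef_pV2 ?posrE// ler_nat ltnS ltnW.
    rewrite lt_min => /andP[ux ux1]; exists n => //=.
    by rewrite in_itv/= ltW//= lerBrDr addrC -lerBrDr ltW.
  move=> [n _] /=; rewrite !in_itv/= => /andP[ux xv].
  by rewrite (lt_le_trans (u0 n) ux)/= (le_lt_trans xv)// gtrBl.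
apply: (@le_lt_trans _ _
  (\int[@lebesgue_measure R]_(z in `]0%R, 1%R[) (f z)%:E)%E).
  apply: ge0_le_integral => //.
  - by move=> x _; rewrite lee_fin mulr_ge0// powR_ge0.
  - apply/measurable_EFinP; apply: measurable_funTS.
    exact: measurable_beta_kernel.
  - by apply/measurable_EFinP; exact: measurable_funTS.
  - move=> x /=; rewrite in_itv/= lee_fin => /andP[x0 x1]; rewrite /f.
    have [x2|x2] := leP x 2^-1.
      rewrite -[leLHS]addr0 lerD ?mulr_ge0 ?powR_ge0//.
      rewrite mulrC ler_wpM2r ?powR_ge0//.
      by apply: powR_le_of_half_le; lra.
    rewrite -[leLHS]add0r lerD ?mulr_ge0 ?powR_ge0// ler_wpM2r ?powR_ge0//.
    by apply: powR_le_of_half_le; lra.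
(* The powers in [F] have positive exponents and are evaluated in [[0, 1]], so each lies between 0
   and 1. *)
apply: (@le_lt_trans _ _ (Kb / a + Ka / b)%:E); last exact: ltry.
rewrite SE; apply: (@ge0_integral_primitive_le _ f F).
- exact: du.
- by move=> m n mn; rewrite lerB// du.
- by move=> n; have := u2 n; lra.
- move=> n x /andP[ux xv].
  have x0 : 0 < x by exact: lt_le_trans (u0 n) ux.
  have x1 : x < 1 by rewrite (le_lt_trans xv)// gtrBl.
  have dp := is_derive1_powR (a - 1) x0.
  have dq := is_derive_powR_onem _ (b - 1) x x1.
  have dpa := is_derive1_powR a x0.
  have dqb := is_derive_powR_onem _ b x x1.
  split=> //.
  rewrite /F; apply: is_derive_eq; rewrite /f /GRing.scale/=.
  by field; apply/andP.
- move=> n.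
  have p1 (x r : R) : 0 <= r -> 0 <= x <= 1 -> 0 <= x `^ r <= 1.
    by move=> r0 x01; rewrite powR_ge0 powR_le1.
  have un := u0 n; have un2 := u2 n.
  have Kab : 0 <= Kb / a by rewrite divr_ge0// ltW.
  have Kba : 0 <= Ka / b by rewrite divr_ge0// ltW.
  rewrite /F.
  have /andP[h1 h2] : 0 <= (1 - u n) `^ a <= 1 by apply: p1; lra.
  have /andP[h3 h4] : 0 <= (u n) `^ a <= 1 by apply: p1; lra.
  have /andP[h5 h6] : 0 <= (1 - u n) `^ b <= 1 by apply: p1; lra.
  have /andP[h7 h8] : 0 <= (1 - (1 - u n)) `^ b <= 1 by apply: p1; lra.
  by nra.
Qed.

(** The logarithmic derivative of [z^a (1-z)^b] is [(a - (a+b) z) / (z (1-z))]; the denominator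
    cancels against [sigma^2] and leaves the linear drift. *)
Lemma is_stationary_pdf_beta (R : realType) (a b : R) (sigma : R -> R) :
  0 < a -> 0 < b ->
  (forall z, 0 < z < 1 -> sigma z ^+ 2 = 2 / (a + b) * (z * (1 - z))) ->
  is_stationary_pdf (fun z => - (z - a / (a + b))) sigma (beta_density a b).
Proof.
move=> a0 b0 sE.
have abN0 : a + b != 0 by rewrite gt_eqF// addr_gt0.
(* Lowering the exponents by one expresses everything in the same two powers, so that [ring] and
   [field] can conclude. *)
have xp x r : 0 < x -> 0 < r -> x `^ r = x * x `^ (r - 1) :> R.
  by move=> x0 r0; rewrite mulr_powRB1// ltW.
apply: (@is_stationary_pdf_normalized _ `]0, 1[%classic _ _ _
  (fun z => 2 / (a + b) * (z `^ a * (1 - z) `^ b))).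
- exact: interval_open.
- have cS : closure (`]0, 1[%classic : set R) `<=` `[0, 1]%classic.
    rewrite [X in _ `<=` X](closure_id _).1; last exact: interval_closed.
    by apply: closureS; exact: subset_itv_oo_cc.
  by move=> x /(interiorS cS); rewrite interior_itv_bnd.
- by rewrite lebesgue_measure_itv/= lte01 oppr0 adde0.
- exact: measurable_beta_kernel.
- move=> x /=; rewrite in_itv/= => /andP[x0 x1].
  by rewrite mulr_gt0 ?powR_gt0// subr_gt0.
- exact: integral_beta_kernel_lty.
- move=> x /=; rewrite in_itv/= => /andP[x0 x1].
  by rewrite sE ?x0// (xp x a)// (xp (1 - x) b) ?subr_gt0//; ring.
- move=> x /=; rewrite in_itv/= => /andP[x0 x1].
  have dp := is_derive1_powR a x0; have dq := is_derive_powR_onem _ b x x1.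
  apply: is_derive_eq.
  by rewrite (xp x a)// (xp (1 - x) b) ?subr_gt0// /GRing.scale/=; field.
- move=> x /=; rewrite in_itv/= => /andP[x0 x1].
  have dp := is_derive1_powR (a - 1) x0.
  have dq := is_derive_powR_onem _ (b - 1) x x1.
  apply: derivableM; first exact: derivableN.
  by apply: derivableM; [case: dp|case: dq].
Qed.

(** * The gamma law *)

Lemma measurable_gamma_kernel (R : realType) (a b : R) :
  measurable_fun [set: R] (fun z => z `^ (a - 1) * expR (- (b * z))).
Proof.
apply: measurable_funM; first exact: measurable_powR.
apply: (measurableT_comp (@measurable_expR R)).
by apply: measurableT_comp => //; exact: measurable_funM.
Qed.

(** Take [ln u <= u] at [u = b z / s] and multiply by [s]; the constant is [(s / b)^s], written as
    an exponential. *)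
Lemma powR_le_expR (R : realType) (b s : R) : 0 < b -> 0 < s ->
  exists2 C, 0 <= C & forall z, 0 < z -> z `^ s <= C * expR (b * z).
Proof.
move=> b0 s0; exists (expR (- (s * ln (b / s)))); first exact: expR_ge0.
move=> z z0; have bs0 : 0 < b / s by rewrite divr_gt0.
rewrite /powR gt_eqF// -expRD ler_expR.
have := ln_sublinear (mulr_gt0 bs0 z0).
rewrite [ln (_ * z)]lnM ?posrE// => h.
have : s * (ln (b / s) + ln z) <= s * (b / s * z) by rewrite ler_wpM2l// ltW.
by rewrite (_ : s * (b / s * z) = b * z); [lra|field; rewrite gt_eqF].
Qed.

(* The integrand is dominated by a multiple of [z^(a-1) / (1+z)^(a+1)], whose
   primitive [(z / (1+z))^a / a] is bounded both at 0 and at infinity. *)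
Lemma integral_gamma_kernel_lty (R : realType) (a b : R) : 0 < a -> 0 < b ->
  (\int[@lebesgue_measure R]_(z in `]0%R, +oo[)
    (z `^ (a - 1) * expR (- (b * z)))%:E < +oo)%E.
Proof.
move=> a0 b0; have aN0 : a != 0 by rewrite gt_eqF.
have [C C0 hC] := powR_le_expR _ _ _ b0 (addr_gt0 a0 ltr01).
(* At [1 + z], [hC] reads [(1+z)^(a+1) <= C exp(b) exp(b z)], whence the factor [expR b]. *)
pose K := C * expR b.
have K0 : 0 <= K by rewrite mulr_ge0// expR_ge0.
pose f (z : R) : R := K * (z `^ (a - 1) * (1 + z) `^ (- a - 1)).
pose F (z : R) : R := K / a * (z `^ a * (1 + z) `^ (- a)).
have f0 z : 0 <= f z by rewrite !mulr_ge0// powR_ge0.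
have mf : measurable_fun [set: R] f.
  apply: measurable_funM => //; apply: measurable_funM => //.
  apply: (measurableT_comp (measurable_powR (- a - 1))).
  exact: measurable_funD.
(* The shift by 2 gives [u n < 1 < v n] already for [n = 0]. *)
pose u (n : nat) : R := n.+2%:R^-1; pose v (n : nat) : R := n.+2%:R.
have u0 n : 0 < u n by rewrite invr_gt0.
have SE : `]0%R, +oo[%classic = \bigcup_n `[u n, v n]%classic.
  apply/seteqP; split=> x /=.
    rewrite in_itv/= andbT => x0.
    have [n /= [nx xn]] := filter_ex (filterI
      (near_infty_natSinv_lt (PosNum x0)) (nbhs_infty_ger x)).
    exists n => //=; rewrite in_itv/=; apply/andP; split.
      by rewrite (le_trans _ (ltW nx))// lef_pV2 ?posrE// ler_nat.
    by rewrite (le_trans xn)// ler_nat -addn2 leq_addr.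
  move=> [n _] /=; rewrite !in_itv/= andbT => /andP[ux _].
  exact: lt_le_trans (u0 n) ux.
apply: (@le_lt_trans _ _
  (\int[@lebesgue_measure R]_(z in `]0%R, +oo[) (f z)%:E)%E).
  apply: ge0_le_integral => //.
  - by move=> x _; rewrite lee_fin mulr_ge0// ?powR_ge0// expR_ge0.
  - apply/measurable_EFinP; apply: measurable_funTS.
    exact: measurable_gamma_kernel.
  - by apply/measurable_EFinP; exact: measurable_funTS.
  - move=> x /=; rewrite in_itv/= andbT lee_fin => x0; rewrite /f mulrCA.
    have x10 : 0 < 1 + x by rewrite addr_gt0.
    rewrite ler_wpM2l ?powR_ge0// -opprD powRN ler_pdivlMr ?powR_gt0//.
    rewrite expRN mulrC ler_pdivrMr ?expR_gt0//.
    rewrite /K -mulrA -expRD (_ : b + b * x = b * (1 + x)); last by ring.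
    exact: hC.
apply: (@le_lt_trans _ _ (K / a)%:E); last exact: ltry.
rewrite SE; apply: (@ge0_integral_primitive_le _ f F).
- by move=> m n mn; rewrite lef_pV2 ?posrE// ler_nat !ltnS.
- by move=> m n mn; rewrite ler_nat !ltnS.
- move=> n; rewrite (@lt_trans _ _ 1)// ?invf_lt1 ?ltr1n//.
- move=> n x /andP[ux xv].
  have x0 : 0 < x by exact: lt_le_trans (u0 n) ux.
  have x10 : 0 < 1 + x by rewrite addr_gt0.
  have dp := is_derive1_powR (a - 1) x0.
  have dpa := is_derive1_powR a x0.
  have dq r : is_derive x 1 (fun y => (1 + y) `^ r) (r * (1 + x) `^ (r - 1)).
    have d1 : is_derive x 1 (fun y : R => 1 + y) 1.
      by apply: is_derive_eq; ring.
    have d2 := is_derive1_powR r x10.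
    have d := @is_derive1_comp _ (fun y => y `^ r) (fun y : R => 1 + y) x _ _
      d2 d1.
    by apply: (is_derive_eq d); rewrite mulr1.
  have dqa := dq (- a); have dqb := dq (- a - 1).
  split=> //.
  rewrite /F; apply: is_derive_eq; rewrite /f /GRing.scale/=.
  (* Once [x^(a-1) (1+x)^(-a-1)] is factored out, what remains is [(1 + x) - x = 1], so [F' = f]. *)
  rewrite -(mulr_powRB1 (ltW x0) a0).
  rewrite (_ : (1 + x) `^ (- a) = (1 + x) * (1 + x) `^ (- a - 1)).
    by field.
  rewrite -[X in X * _]powRr1 ?(ltW x10)// -powRD.
    by congr powR; ring.
  by rewrite (gt_eqF x10) implybT.
- move=> n.
  have F0 z : 0 <= F z by rewrite !mulr_ge0 ?powR_ge0// invr_ge0 ltW.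
  (* The term [F (u n)] is nonnegative and is dropped; the bound on [F (v n)] is
     [v^a <= (1 + v)^a]. *)
  rewrite (le_trans (_ : _ <= F (v n))) ?gerBl// /F.
  have v0 : 0 < v n by rewrite ltr0n.
  rewrite ler_piMr ?divr_ge0 ?(ltW a0)// powRN.
  rewrite ler_pdivrMr ?powR_gt0 ?addr_gt0//.
  by rewrite mul1r ge0_ler_powR ?nnegrE ?lerDr ?addr_ge0 ?ltW.
Qed.

(** The logarithmic derivative of [z^a exp(-b z)] is [(a - b z) / z]; again the denominator cancels
    against [sigma^2]. *)
Lemma is_stationary_pdf_gamma (R : realType) (a b : R) (sigma : R -> R) :
  0 < a -> 0 < b -> (forall z, 0 < z -> sigma z ^+ 2 = 2 * z / b) ->
  is_stationary_pdf (fun z => - (z - a / b)) sigma (gamma_density a b).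
Proof.
move=> a0 b0 sE; have bN0 : b != 0 by rewrite gt_eqF.
have xp (x : R) : 0 < x -> x `^ a = x * x `^ (a - 1).
  by move=> x0; rewrite mulr_powRB1// ltW.
apply: (@is_stationary_pdf_normalized _ `]0, +oo[%classic _ _ _
  (fun z => 2 / b * (z `^ a * expR (- (b * z))))).
- exact: interval_open.
- have cS : closure (`]0, +oo[%classic : set R) `<=` `[0, +oo[%classic.
    rewrite [X in _ `<=` X](closure_id _).1; last exact: interval_closed.
    by apply: closureS => x /=; rewrite !in_itv/= !andbT; exact: ltW.
  by move=> x /(interiorS cS); rewrite interior_itv_bndy.
- by rewrite lebesgue_measure_itv/= ltry oppr0 adde0 ltry.
- exact: measurable_gamma_kernel.
- move=> x /=; rewrite in_itv/= andbT => x0.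
  by rewrite mulr_gt0 ?powR_gt0// expR_gt0.
- exact: integral_gamma_kernel_lty.
- move=> x /=; rewrite in_itv/= andbT => x0.
  by rewrite sE// xp//; field.
- move=> x /=; rewrite in_itv/= andbT => x0.
  have dp := is_derive1_powR a x0.
  by apply: is_derive_eq; rewrite xp// /GRing.scale/=; field.
- move=> x /=; rewrite in_itv/= andbT => x0.
  have dp := is_derive1_powR (a - 1) x0.
  apply: derivableM; first exact: derivableN.
  by apply: derivableM; [case: dp|exact: ex_derive].
Qed.

Theorem corollary1 (R : realType) :
  [/\ forall (a b : R) (sigma : R -> R), 0 < b ->
        (forall z, sigma z ^+ 2 = 2 * b) ->
        is_stationary_pdf (fun z => - (z - a)) sigma (gaussian_density a b),
      forall (a b : R) (sigma : R -> R), 0 < a -> 0 < b ->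
        (forall z, 0 < z < 1 -> sigma z ^+ 2 = 2 / (a + b) * (z * (1 - z))) ->
        is_stationary_pdf (fun z => - (z - a / (a + b))) sigma
          (beta_density a b),
      forall (a b : R) (sigma : R -> R), 0 < a -> 0 < b ->
        (forall z, 0 < z -> sigma z ^+ 2 = 2 * z / b) ->
        is_stationary_pdf (fun z => - (z - a / b)) sigma (gamma_density a b)
    & forall (a b : R) (sigma : R -> R), 0 < b ->
        (forall z, sigma z ^+ 2 = 2 * b * `|z - a| + 2 * b ^+ 2) ->
        is_stationary_pdf (fun z => - (z - a)) sigma (laplace_density a b)].
Proof.
split=> a b sigma; [exact: is_stationary_pdf_gaussian|
  exact: is_stationary_pdf_beta|exact: is_stationary_pdf_gamma|
  exact: is_stationary_pdf_laplace].
Qed.
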